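(* Let $n,k\ge1$ and let $\mathcal{S}_n^k$ be the extended Shi arrangement in $\mathbb{R}^n$ consisting of the hyperplanes $x_i-x_j=l$ for all $1\le i<j\le n$ and all integers $-k+1\le l\le k$. The map $\sigma_n^k$ (defined below) is a bijection between the regions of $\mathcal{S}_n^k$ and the $k$-parking functions on $[n]$.
   Context: A region of an arrangement is a connected component of the complement of the union of its hyperplanes. A $k$-parking function on $[n]$ is a sequence of positive integers $(a_1,\ldots,a_n)$ whose increasing rearrangement $b_1\le\cdots\le b_n$ satisfies $b_i\le 1+k(i-1)$ for all $i$. The diagram of a region $R$ of $\mathcal{S}_n^k$ is defined as follows. Let $y=y_1y_2\cdots y_{kn}$ be the unique ordering of the $kn$ expressions $x_i+m$ ($1\le i\le n$, $0\le m\le k-1$) such that $y_1>y_2>\cdots>y_{kn}$ holds on $R$ (determined by the hyperplanes $x_i-x_j=l$, $-k+1\le l\le k-1$); the position of $y_p$ is $p$. Draw an arc from $x_i+m$ to $x_i+m-1$ for all $i$ and all $0<m\le k-1$, and draw an arc from $x_i$ to $x_j+k-1$ whenever $i<j$ and $x_i-x_j>k$ holds on $R$ (arcs go rightwards). Remove every arc that contains another arc, i.e. an arc from $p$ to $q$ is removed if there is a different arc from $p'$ to $q'$ with $p$ weakly left of $p'$ and $q'$ weakly left of $q$. Replace each $x_i+m$ by $i$. The remaining arcs partition the multiset $\{1^k,2^k,\ldots,n^k\}$ into chains (connected components) of weakly increasing integers, with all $k$ copies of $i$ in the same chain. The map $\sigma_n^k$ sends $R$ to $(a_1,\ldots,a_n)$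 where $a_i$ is the position of the leftmost element of the chain containing the copies of $i$. *)

(* Defs.v *)
From HB Require Import structures.
From mathcomp Require Import all_boot all_order all_algebra.
From mathcomp Require Import all_classical all_reals all_analysis.
Set Implicit Arguments. Unset Strict Implicit. Unset Printing Implicit Defensive.
Import numFieldNormedType.Exports.
Import Order.TTheory GRing.Theory Num.Theory.
Local Open Scope classical_set_scope.
Local Open Scope ring_scope.

Section ShiDefs.
Variables (R : realType) (n k : nat).

Definition coord (x : 'rV[R]_n) (i : 'I_n) : R := x ord0 i.

Definition shi_complement : set 'rV[R]_n :=
  [set x | forall (i j : 'I_n), (i < j)%N ->
     forall l : int, (- (k%:Z) + 1 <= l)%R -> (l <= k%:Z)%R ->
       coord x i - coord x j != l%:~R].

Definition shi_region (A : set 'rV[R]_n) : Prop :=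
  exists2 x, shi_complement x & A = connected_component shi_complement x.

Definition vval (x : 'rV[R]_n) (u : 'I_n * 'I_k) : R :=
  coord x u.1 + (val u.2)%:R.

(* Position (1-based) of x_i + m in the decreasing ordering y_1 > ... > y_kn. *)
Definition vpos (x : 'rV[R]_n) (u : 'I_n * 'I_k) : nat :=
  #|[pred v : 'I_n * 'I_k | vval x u < vval x v]|.+1.

Definition arc0 (x : 'rV[R]_n) (u v : 'I_n * 'I_k) : bool :=
  ((u.1 == v.1) && (val u.2 == (val v.2).+1)) ||
  [&& (u.1 < v.1)%N, val u.2 == 0%N, val v.2 == k.-1
    & coord x u.1 - coord x v.1 > k%:R].

(* Arcs remaining after removing every arc that contains a different arc. *)
Definition arc (x : 'rV[R]_n) (u v : 'I_n * 'I_k) : bool :=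
  arc0 x u v &&
  ~~ [exists u' : 'I_n * 'I_k, exists v' : 'I_n * 'I_k,
        [&& arc0 x u' v', (u', v') != (u, v),
            (vpos x u <= vpos x u')%N & (vpos x v' <= vpos x v)%N]].

(* Undirected adjacency: chains are connected components of this graph. *)
Definition adj (x : 'rV[R]_n) : rel ('I_n * 'I_k) :=
  fun u v => arc x u v || arc x v u.

(* a_i = position of the leftmost element of the chain containing the copies
   of i (taken over all elements connected to some copy of i). *)
Definition sigma_pt (x : 'rV[R]_n) : {ffun 'I_n -> nat} :=
  [ffun i => \big[minn/(k * n).+1]_(v : 'I_n * 'I_k |
                 [exists m : 'I_k, connect (adj x) (i, m) v]) vpos x v].

Definition sigma (A : set 'rV[R]_n) : {ffun 'I_n -> nat} :=
  sigma_pt (xget 0 A).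

End ShiDefs.

Definition k_parking (n k : nat) (a : {ffun 'I_n -> nat}) : bool :=
  [forall i, 0 < a i]%N &&
  (let b := sort leq [seq a i | i : 'I_n] in
   [forall i : 'I_n, nth 0 b i <= 1 + k * i]%N).

(* Main.v *)
Require Import Defs.
From HB Require Import structures.
From mathcomp Require Import all_boot all_order all_algebra.
From mathcomp Require Import all_classical all_reals all_analysis.
From mathcomp Require Import zify ring lra.
Import numFieldNormedType.Exports.

(** Every arc spans a difference of at least [1], with equality exactly for the
    arcs joining consecutive copies of a letter, so these are never removed; the
    remaining arcs are pairwise non-nested, hence the chains are directed paths
    and are the level sets of [a = sigma x], with arcs determined by [a].

    Injectivity: reading positions from left to right, a position holds either
    the start of the chain it labels or the end of the open arc with the leftmost
    origin (first in, first out), so [a] determines the word.  Moreover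
    [x_i - x_j > k] holds iff some remaining arc lies between [x_i] and
    [x_j + k - 1].  Thus [a] determines the side of every hyperplane, and points
    on the same side of all hyperplanes are joined by a segment in the complement.

    Surjectivity: for a parking function the first-in first-out reading never
    gets stuck, since the first [kt + 1] positions always see at least [t + 1]
    letters.  The resulting non-nesting arcs are realized by real numbers chosen
    greedily from left to right. *)

Set Implicit Arguments.
Unset Strict Implicit.
Unset Printing Implicit Defensive.

(** * Chains and their reading order *)

Section Connect.
Variables (T : finType) (e : rel T).

Lemma connect_inv_head u v :
  connect e u v -> u = v \/ exists2 w, e u w & connect e w v.
Proof.
case/connectP => [[|w p]] /=; first by move=> _ ->; left.
by case/andP=> euw pw ->; right; exists w => //; apply/connectP; exists p.
Qed.

Lemma connect_inv_last u v :
  connect e u v -> u = v \/ exists2 w, connect e u w & e w v.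
Proof.
case/connectP => p; case/lastP: p => [|p w] /=; first by move=> _ ->; left.
rewrite rcons_path last_rcons => /andP[pw ew] ->; right.
by exists (last u p) => //; apply/connectP; exists p.
Qed.

Lemma connect_ind (P : T -> Prop) u v :
  (forall w w', P w -> e w w' -> P w') -> connect e u v -> P u -> P v.
Proof.
move=> Pe /connectP[p + ->]; elim: p u => //= w p IH u /andP[euw pw] Pu.
by apply: IH => //; apply: Pe euw.
Qed.

End Connect.

Section ConnectPaths.
Variables (T : finType) (e : rel T).
Hypothesis succ_uniq : forall u v v', e u v -> e u v' -> v = v'.
Hypothesis pred_uniq : forall u u' v, e u v -> e u' v -> u = u'.

(* Components of a graph with in- and out-degrees at most one are directed
   paths. *)
Lemma connect_undirected_total u v :
  connect [rel a b | e a b || e b a] u v -> connect e u v \/ connect e v u.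
Proof.
move=> uv; apply: (connect_ind (P := fun v => connect e u v \/ connect e v u) _ uv);
  last by left.
move=> {uv}v w uv /= /orP[vw|wv]; case: uv => [uv|vu].
- by left; apply: connect_trans uv (connect1 vw).
- case: (connect_inv_head vu) => [<-|[z vz zu]]; first by left; apply: connect1.
  by right; rewrite (succ_uniq vw vz).
- case: (connect_inv_last uv) => [->|[z uz zv]]; first by right; apply: connect1.
  by left; rewrite (pred_uniq wv zv).
- by right; apply: connect_trans (connect1 wv) vu.
Qed.

End ConnectPaths.

(** * Chains attached to a label function, and the orders in which they can be read *)

Section ChainArcs.
Import Order.TTheory.
Variables n k : nat.
Local Notation V := ('I_n * 'I_k)%type.
Implicit Types (a : {ffun 'I_n -> nat}) (u v w : V) (i j l : 'I_n).

(* The arcs of the chains attached to [a]: the chain with leftmost position [p]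
   runs through the [k] copies of every [i] with [a i = p], by increasing [i]. *)
Definition chain_arc a u v : bool :=
  ((u.1 == v.1) && (val u.2 == (val v.2).+1)) ||
  [&& (u.1 < v.1)%N, val u.2 == 0%N, val v.2 == k.-1, a u.1 == a v.1
    & [forall l : 'I_n, (u.1 < l < v.1)%N ==> (a l != a u.1)]].

Definition chain_start a v : bool := [forall u, ~~ chain_arc a u v].

Lemma chain_arcP a u v : reflect
  ((u.1 = v.1 /\ u.2 = v.2.+1 :> nat) \/
   [/\ (u.1 < v.1)%N, u.2 = 0%N :> nat, v.2 = k.-1 :> nat, a u.1 = a v.1
     & forall l, (u.1 < l < v.1)%N -> a l <> a u.1]) (chain_arc a u v).
Proof.
apply: (iffP orP) => -[h|h]; [left|right|left|right].
- by case/andP: h => /eqP-> /eqP->.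
- case/and5P: h => -> /eqP-> /eqP-> /eqP-> /forallP h; split=> // l ll.
  by move: (h l); rewrite ll => /eqP.
- by case: h => e1 e2; apply/andP; split; apply/eqP.
- case: h => -> e1 e2 e3 h; apply/and5P; split=> //; try exact/eqP.
  by apply/forallP => l; apply/implyP => /h/eqP.
Qed.

Lemma pair_val_inj u v : u.1 = v.1 :> nat -> u.2 = v.2 :> nat -> u = v.
Proof. by case: u v => [i m] [j m'] /= /val_inj-> /val_inj->. Qed.

Lemma chain_arc_class a u v : chain_arc a u v -> a u.1 = a v.1.
Proof. by case/chain_arcP=> [[->]|[]]. Qed.

Lemma chain_arc_succ_uniq a u v v' :
  chain_arc a u v -> chain_arc a u v' -> v = v'.
Proof.
case/chain_arcP=> [[e m]|[lt m m' e h]]; case/chain_arcP=> [[e1 m1]|[lt1 m1 m1' e1 h1]].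
- by apply: pair_val_inj; [rewrite -e -e1 | lia].
- by lia.
- by lia.
- apply: pair_val_inj; last by lia.
  case: (ltngtP v.1 v'.1) => // c.
  + by case: (h1 v.1); rewrite ?lt.
  + by case: (h v'.1); rewrite ?lt1.
Qed.

Lemma chain_arc_pred_uniq a u u' v :
  chain_arc a u v -> chain_arc a u' v -> u = u'.
Proof.
case/chain_arcP=> [[e m]|[lt m m' e h]]; case/chain_arcP=> [[e1 m1]|[lt1 m1 m1' e1 h1]].
- by apply: pair_val_inj; [rewrite e e1 | lia].
- by have := ltn_ord u.2; lia.
- by have := ltn_ord u'.2; lia.
- apply: pair_val_inj; last by lia.
  case: (ltngtP u.1 u'.1) => // c.
  + by case: (h u'.1); rewrite ?lt1 ?c // e e1.
  + by case: (h1 u.1); rewrite ?lt ?c // e e1.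
Qed.

(** This rank lists the letters in increasing order, and the copies of a letter from [k.-1] down to
    [0]. It makes walking backwards along arcs terminate, which is how every element is traced to a
    chain start. *)
Lemma chain_arc_rank a u v : chain_arc a u v ->
  (k * u.1 + (k.-1 - u.2) < k * v.1 + (k.-1 - v.2))%N.
Proof.
have ku := ltn_ord u.2; have kv := ltn_ord v.2.
case/chain_arcP=> [[-> m]|[lt m m' _ _]]; first by lia.
have : (k * u.1.+1 <= k * v.1)%N by rewrite leq_mul2l lt orbT.
by rewrite mulnS; lia.
Qed.

Lemma chain_start_exists a v :
  exists2 s, chain_start a s & connect (chain_arc a) s v.
Proof.
have [N] := ubnP (k * v.1 + (k.-1 - v.2))%N; elim: N => // N IH in v *.
rewrite ltnS => vN; have [sv|] := boolP (chain_start a v); first by exists v.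
rewrite negb_forall => /existsP[u]; rewrite negbK => uv.
have [|s ss su] := IH u; first by apply: leq_trans (chain_arc_rank uv) vN.
by exists s => //; apply: connect_trans su (connect1 uv).
Qed.

Lemma chain_connect_class a u v : connect (chain_arc a) u v -> a u.1 = a v.1.
Proof.
move=> uv; apply: (connect_ind (P := fun w => a u.1 = a w.1) _ uv) => // w w' ->.
exact: chain_arc_class.
Qed.

Lemma chain_start_copy a v : chain_start a v -> v.2 = k.-1 :> nat.
Proof.
move=> /forallP sv; have kv := ltn_ord v.2.
case: (ltngtP v.2 k.-1) => // lt; last by lia.
have h : (v.2.+1 < k)%N by lia.
by case/negP: (sv (v.1, Ordinal h)); apply/chain_arcP; left.
Qed.

Lemma chain_start_min a v l : chain_start a v -> (l < v.1)%N -> a l <> a v.1.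
Proof.
move=> sv lv al; have hk : (0 < k)%N by case: (k) v.2 => [[]|].
(* The largest smaller letter with the same label sends an arc from its copy [0] into [v]. *)
pose P := [pred l : 'I_n | (l < v.1)%N && (a l == a v.1)].
have Pl : P l by rewrite /= lv al eqxx.
case: (arg_maxnP val Pl) => i /andP[iv /eqP ai] maxi.
move/forallP: (sv) => /(_ (i, Ordinal hk)) /negP; apply; apply/chain_arcP; right.
split=> //=; first exact: chain_start_copy sv.
move=> l' /andP[l1 l2] al'; have /maxi /= : P l' by rewrite /= l2 al' ai eqxx.
by lia.
Qed.

Lemma chain_start_uniq a v v' :
  chain_start a v -> chain_start a v' -> a v.1 = a v'.1 -> v = v'.
Proof.
move=> sv sv' e; apply: pair_val_inj; last by rewrite !(@chain_start_copy a).
case: (ltngtP v.1 v'.1) => // c.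
- by case: (chain_start_min sv' c).
- by case: (chain_start_min sv c).
Qed.

(** Combinatorial abstraction of the diagram of a region with image [a]: the positions of any point
    of the complement satisfy it for their own labels, and any instance comes from a point. *)
Record parking_order a (pos : V -> nat) : Prop := ParkingOrder {
  parking_order_inj : injective pos;
  parking_order_bound : forall v, (0 < pos v <= k * n)%N;
  parking_order_start : forall v, chain_start a v -> pos v = a v.1;
  parking_order_arc : forall u v, chain_arc a u v -> (pos u < pos v)%N;
  parking_order_nonnesting : forall u v u' v',
    chain_arc a u v -> chain_arc a u' v' -> (pos u < pos u')%N ->
    (pos v < pos v')%N
}.

(** Pigeonhole: [pos] injects the [k * n] elements into [k * n] positions. *)
Lemma parking_order_perm a pos : parking_order a pos ->
  perm_eq [seq pos v | v : V] (iota 1 (k * n)).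
Proof.
move=> po; apply: uniq_perm; rewrite ?iota_uniq //.
  by rewrite map_inj_uniq ?enum_uniq //; apply: parking_order_inj po.
have []// := @uniq_min_size _ [seq pos v | v : V] (iota 1 (k * n)).
- by rewrite map_inj_uniq ?enum_uniq //; apply: parking_order_inj po.
- move=> p /mapP[v _ ->]; rewrite mem_iota add1n ltnS.
  exact: parking_order_bound po v.
- by rewrite size_map -cardE card_prod !card_ord size_iota mulnC.
Qed.

Lemma parking_order_surj a pos p : parking_order a pos ->
  (0 < p <= k * n)%N -> exists v, pos v = p.
Proof.
move=> po pb; have : p \in iota 1 (k * n) by rewrite mem_iota add1n ltnS.
by rewrite -(perm_mem (parking_order_perm po)) => /mapP[v _ ->]; exists v.
Qed.

Lemma parking_order_card a pos p : parking_order a pos -> (p <= k * n)%N ->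
  #|[pred v : V | (pos v <= p)%N]| = p.
Proof.
move=> po pb; rewrite cardE /enum_mem size_filter.
have -> : count [pred v : V | (pos v <= p)%N] (Finite.enum V) =
    count (fun q => q <= p)%N [seq pos v | v : V].
  by rewrite count_map enumT.
rewrite (permP (parking_order_perm po)) -{1}(subnKC pb) iotaD count_cat.
have -> : count (fun q => q <= p)%N (iota 1 p) = p.
  transitivity (size (iota 1 p)); last by rewrite size_iota.
  by apply/eqP; rewrite -all_count; apply/allP => q; rewrite mem_iota; lia.
have -> : count (fun q => q <= p)%N (iota (1 + p) (k * n - p)) = 0%N.
  apply/eqP; rewrite -leqn0 leqNgt -has_count; apply/hasPn => q.
  by rewrite mem_iota; lia.
by rewrite addn0.
Qed.

(* The arcs are never nested, so reading positions from left to right the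
   element at a position where no chain starts continues the open arc with the
   leftmost origin. *)
Lemma parking_order_uniq a pos pos' :
  parking_order a pos -> parking_order a pos' -> pos =1 pos'.
Proof.
move=> po po'.
have IH p : forall v, pos v = p <-> pos' v = p.
  have [N] := ubnP p; elim: N => // N IH in p *; rewrite ltnS => pN.
  have {}IH q : (q < p)%N -> forall v, pos v = q <-> pos' v = q.
    by move=> qp; apply: IH; apply: leq_trans qp pN.
  have key v v' : pos v = p -> pos' v' = p -> v = v'.
    move=> vp vp'; have [sv|] := boolP (chain_start a v).
      apply: (parking_order_inj po').
      by rewrite (parking_order_start po' sv) -(parking_order_start po sv) vp vp'.
    rewrite negb_forall => /existsP[u]; rewrite negbK => uv.
    have [sv'|] := boolP (chain_start a v').
      apply: (parking_order_inj po).
      by rewrite (parking_order_start po sv') -(parking_order_start po' sv') vp vp'.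
    rewrite negb_forall => /existsP[u']; rewrite negbK => uv'.
    have up : (pos u < p)%N by rewrite -vp (parking_order_arc po).
    have up' : (pos' u' < p)%N by rewrite -vp' (parking_order_arc po').
    have eu : pos' u = pos u by apply/(IH _ up).
    have eu' : pos u' = pos' u' by apply/(IH _ up').
    (* If the two predecessors differed, the arc with the origin further left would, in the order
       where it is not the one read at [p], end before [p]; by induction it would end there in both
       orders. *)
    case: (ltngtP (pos u) (pos u')) => c.
    - have := parking_order_nonnesting po' uv uv'; rewrite eu -eu' vp' => /(_ c) lt.
      by move: (lt); rewrite -((IH _ lt v).2 erefl) vp ltnn.
    - have := parking_order_nonnesting po uv' uv; rewrite vp => /(_ c) lt.
      by move: (lt); rewrite -((IH _ lt v').1 erefl) vp' ltnn.
    - have uu := parking_order_inj po c; rewrite -uu in uv'.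
      exact: chain_arc_succ_uniq uv uv'.
  move=> v; split=> vp.
  - have [|v' vp'] := @parking_order_surj _ _ p po'.
      by rewrite -vp (parking_order_bound po).
    by rewrite (key v v').
  - have [|v' vp'] := @parking_order_surj _ _ p po.
      by rewrite -vp (parking_order_bound po').
    by rewrite -(key v' v).
by move=> v; symmetry; apply/IH.
Qed.

Lemma parking_order_connect a pos u v : parking_order a pos ->
  connect (chain_arc a) u v -> (pos u <= pos v)%N.
Proof.
move=> po uv.
apply: (connect_ind (P := fun w => (pos u <= pos w)%N) _ uv) => // w w' uw ww'.
exact: leq_trans uw (ltnW (parking_order_arc po ww')).
Qed.

Lemma parking_order_ge a pos v : parking_order a pos -> (a v.1 <= pos v)%N.
Proof.
move=> po; have [s ss sv] := chain_start_exists a v.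
rewrite -(chain_connect_class sv) -(parking_order_start po ss).
exact: parking_order_connect po sv.
Qed.

(** The sorted entry of zero-based index [t] is at most a bound exactly when more than [t] entries
    are. *)
Lemma k_parkingP a : reflect
  ((forall i, 0 < a i)%N /\
   (forall t, t < n -> t < #|[pred i | a i <= 1 + k * t]|)%N) (k_parking k a).
Proof.
have E t : (t < n)%N -> (nth 0%N (sort leq [seq a i | i : 'I_n]) t <= 1 + k * t)%N =
   (t < #|[pred i | a i <= 1 + k * t]|)%N.
  move=> tn; set c := (1 + k * t)%N; set s := sort _ _.
  have ss : sorted leq s by apply: sort_sorted; apply: leq_total.
  have sz : size s = n by rewrite size_sort size_map size_enum_ord.
  have cs : count (fun q => q <= c)%N s = #|[pred i | a i <= c]|%N.
    rewrite (permP (permEl (perm_sort leq _))) count_map enumT.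
    by rewrite cardE /enum_mem size_filter.
  rewrite -cs; apply/idP/idP => [|h]; last exact: (nth_count_le _ ss h).
  apply: contraTT; rewrite -leqNgt -ltnNge => h.
  by apply: (nth_count_gt _ ss); rewrite sz tn andbT.
apply: (iffP andP) => -[h1 h2]; split.
- exact/forallP.
- by move=> t tn; rewrite -E //; move/forallP: h2 => /(_ (Ordinal tn)).
- exact/forallP.
- by apply/forallP => i; rewrite E //; apply: h2.
Qed.

(** No element stands to the left of its label, so the first [1 + k * t] positions hold only copies
    of letters with label at most [1 + k * t]. Each letter has [k] copies, so there are more than
    [t] such letters. *)
Lemma parking_order_k_parking a pos : (0 < k)%N ->
  parking_order a pos -> k_parking k a.
Proof.
move=> hk po; apply/k_parkingP; split=> [i|t tn].
  have [s ss si] := chain_start_exists a (i, Ordinal hk).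
  rewrite -(chain_connect_class si) -(parking_order_start po ss).
  by case/andP: (parking_order_bound po s).
have b : (1 + k * t <= k * n)%N.
  by apply: (@leq_trans (k * t.+1)); rewrite ?leq_mul2l ?tn ?orbT // mulnS leq_add2r.
set A := [pred i | _]; have := parking_order_card po b => cb.
suff : (1 + k * t <= #|A| * k)%N.
  by rewrite [(#|A| * k)%N]mulnC add1n ltn_mul2l => /andP[].
have <- : #|[predX A & 'I_k]| = (#|A| * k)%N by rewrite cardX card_ord.
rewrite -[X in (X <= _)%N]cb; apply: subset_leq_card; apply/fintype.subsetP => u; rewrite !inE andbT.
exact: leq_trans (parking_order_ge _ po).
Qed.

(** [s] fills the first [size s] positions; indices start at [0] and positions at [1]. An absent
    element has index [size s], so [partial_arc] also puts the origin of an arc ending in [s] into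
    [s]. *)
Record partial_parking_order a (s : seq V) : Prop := PartialParkingOrder {
  partial_uniq : uniq s;
  partial_start_mem : forall v, chain_start a v -> (v \in s) = (a v.1 <= size s)%N;
  partial_start : forall v, chain_start a v -> v \in s -> (index v s).+1 = a v.1;
  partial_arc : forall u v, chain_arc a u v -> v \in s -> (index u s < index v s)%N;
  partial_nonnesting : forall u v u' v',
    chain_arc a u v -> chain_arc a u' v' -> v' \in s ->
    (index u s < index u' s)%N -> (index v s < index v' s)%N
}.

Lemma index_rcons (T : eqType) (s : seq T) (w v : T) :
  index v (rcons s w) = if v \in s then index v s else (size s + (v != w))%N.
Proof.
rewrite -cats1 index_cat; case: ifP => //= _.
by rewrite eq_sym; case: eqP.
Qed.

(** The next position receives the chain start labelled by it, if there is one, and otherwise the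
    end of the open arc with the leftmost origin. *)
Lemma partial_parking_order_step a s : k_parking k a ->
  (size s < k * n)%N -> partial_parking_order a s ->
  exists w, partial_parking_order a (rcons s w).
Proof.
move=> /k_parkingP[a0 ap] sn ps; case: (ps) => us sm si sa sx.
have memlt v : v \in s -> (index v s < size s)%N by rewrite index_mem.
have ltmem v p : (p < size s)%N -> (index v s <= p)%N -> v \in s.
  by move=> ps' le; rewrite -index_mem (leq_ltn_trans le).
have nlt v p : v \in s -> (size s + p < index v s)%N = false.
  by move=> /memlt/ltnW le; rewrite ltnNge (leq_trans le) // leq_addr.
have [/existsP[w /andP[sw /eqP aw]]|nos] :=
  boolP [exists w, chain_start a w && (a w.1 == (size s).+1)].
  have ws : w \notin s by rewrite sm // aw ltnn.
  exists w; split.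
  - by rewrite rcons_uniq ws.
  - move=> v sv; rewrite mem_rcons inE size_rcons sm // [RHS]leq_eqVlt ltnS.
    congr (_ || _); apply/eqP/eqP => [->//|e].
    by apply: (chain_start_uniq sv sw); rewrite e aw.
  - move=> v sv; rewrite mem_rcons inE index_rcons; case: ifP => [vs _|vs]; first exact: si.
    by rewrite orbF => /eqP->; rewrite eqxx addn0 aw.
  - move=> u v uv; rewrite mem_rcons inE => /orP[/eqP vw|vs].
      by move/forallP: sw => /(_ u); rewrite -vw uv.
    have lt := sa _ _ uv vs; have us' := ltmem u _ (memlt _ vs) (ltnW lt).
    by rewrite !index_rcons us' vs.
  - move=> u v u' v' uv uv'; rewrite mem_rcons inE => /orP[/eqP vw|vs].
      by move/forallP: sw => /(_ u'); rewrite -vw uv'.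
    have lt' := sa _ _ uv' vs; have us' := ltmem u' _ (memlt _ vs) (ltnW lt').
    rewrite !index_rcons us' vs; case: ifP => [us1 c|_]; last by rewrite nlt.
    have lt := sx _ _ _ _ uv uv' vs c.
    by rewrite (ltmem v _ (memlt _ vs) (ltnW lt)).
pose C := [pred u | (u \in s) && [exists w, (w \notin s) && chain_arc a u w]].
have [u0 Cu0] : exists u, C u.
  (* With no open arc, [s] is closed under arcs and contains all copies of the letters labelled at
     most [(size s).+1], since no chain starts at that last position. For [t = size s %/ k] the
     parking condition yields at least [t.+1] such letters, hence [k * t.+1] elements in [s], too
     many. *)
  apply/existsP; apply: contraT; rewrite negb_exists => /forallP nC.
  have cl u v : u \in s -> chain_arc a u v -> v \in s.
    move=> us' uv; apply: contraT => vs; move: (nC u); rewrite /= us' /=.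
    by move=> /negP[]; apply/existsP; exists v; rewrite vs.
  have allin (i : 'I_n) (m : 'I_k) : (a i <= (size s).+1)%N -> (i, m) \in s.
    move=> ai; have [t st ti] := chain_start_exists a (i, m).
    have at_ := chain_connect_class ti; rewrite /= in at_.
    have ts : t \in s.
      rewrite sm // at_ -ltnS ltn_neqAle ai andbT; apply: contra nos => e.
      by apply/existsP; exists t; rewrite st at_.
    by apply: (connect_ind (P := fun w => w \in s) _ ti) => // w w'; apply: cl.
  have hk : (0 < k)%N by have := leq_ltn_trans (leq0n _) sn; rewrite muln_gt0 => /andP[].
  pose t := (size s %/ k)%N.
  have tn : (t < n)%N by rewrite ltn_divLR // mulnC.
  have := ap t tn; set A := [pred i | _] => At.
  suff : (#|A| * k <= size s)%N.
    move=> le; have := ltn_ceil (size s) hk.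
    by rewrite ltnNge (leq_trans _ le) // leq_mul2r At orbT.
  have <- : #|[predX A & 'I_k]| = (#|A| * k)%N by rewrite cardX card_ord.
  rewrite -(card_uniqP us); apply: subset_leq_card; apply/fintype.subsetP => -[i m].
  rewrite !inE /= andbT => ai; apply: allin; apply: leq_trans ai _.
  by rewrite add1n ltnS mulnC leq_divM.
(* The leftmost choice preserves non-nesting: an arc with an origin further left is already
   closed. *)
case: (arg_minnP (fun u => index u s) Cu0) => u /andP[us' /existsP[w /andP[ws uw]]] minu.
have nsw : ~~ chain_start a w by apply/negP => /forallP/(_ u); rewrite uw.
exists w; split.
- by rewrite rcons_uniq ws.
- move=> v sv; rewrite mem_rcons inE size_rcons sm //.
  have -> : (v == w) = false by apply/negP => /eqP vw; rewrite vw (negbTE nsw) in sv.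
  rewrite [RHS]leq_eqVlt ltnS (_ : (_ == _) = false) //.
  by apply: contraNF nos => e; apply/existsP; exists v; rewrite sv.
- move=> v sv; rewrite mem_rcons inE index_rcons; case: ifP => [vs _|vs]; first exact: si.
  by rewrite orbF => /eqP vw; rewrite vw (negbTE nsw) in sv.
- move=> u' v uv; rewrite mem_rcons inE => /orP[/eqP vw|vs].
    rewrite vw in uv *; rewrite (chain_arc_pred_uniq uv uw) !index_rcons us' (negbTE ws).
    by rewrite eqxx addn0 memlt.
  have lt := sa _ _ uv vs; have us1 := ltmem u' _ (memlt _ vs) (ltnW lt).
  by rewrite !index_rcons us1 vs.
- move=> u1 v u' v' uv uv'; rewrite mem_rcons inE => /orP[/eqP vw|vs].
    rewrite vw in uv' *; rewrite (chain_arc_pred_uniq uv' uw) !index_rcons us' (negbTE ws).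
    rewrite eqxx addn0; case: ifP => [us1 c|_]; last by rewrite nlt.
    case: ifP => [/memlt//|/negbT vs].
    have /minu /= : C u1 by rewrite /= us1; apply/existsP; exists v; rewrite vs uv.
    by rewrite leqNgt c.
  have lt' := sa _ _ uv' vs; have us1 := ltmem u' _ (memlt _ vs) (ltnW lt').
  rewrite !index_rcons us1 vs; case: ifP => [us2 c|_]; last by rewrite nlt.
  have lt := sx _ _ _ _ uv uv' vs c.
  by rewrite (ltmem v _ (memlt _ vs) (ltnW lt)).
Qed.

Lemma parking_order_exists a : k_parking k a -> exists pos, parking_order a pos.
Proof.
move=> pa; have [s ss ps] : exists2 s, size s = (k * n)%N & partial_parking_order a s.
  (* Induction on the length of the list. The empty list is a valid start because labels are
     positive. *)
  have : (k * n <= k * n)%N by []; elim: {1 3}(k * n)%N => [|N IH] Nn.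
    exists [::] => //; split=> // v sv; rewrite in_nil.
    by case/k_parkingP: pa => /(_ v.1); case: (a v.1).
  have [s ss ps] := IH (ltnW Nn); have [|w pw] := partial_parking_order_step pa _ ps.
    by rewrite ss.
  by exists (rcons s w) => //; rewrite size_rcons ss.
case: ps => us sm si sa sx.
have alls v : v \in s.
  have /subset_cardP : #|s| = #|{: V}|.
    by rewrite (card_uniqP us) ss card_prod !card_ord mulnC.
  by move=> /(_ (subset_predT _))->.
exists (fun v => (index v s).+1); split.
- by move=> u v [] /index_inj; apply.
- by move=> v; rewrite -ss index_mem alls.
- by move=> v sv; apply: si.
- by move=> u v uv; apply: sa.
- by move=> u v u' v' uv uv'; apply: sx.
Qed.

End ChainArcs.

(** * Realization by real numbers *)

Section Realization.
Local Open Scope ring_scope.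
Import Order.TTheory GRing.Theory Num.Theory.
Variable R : realType.

(** Density of the order, applied finitely often: [above] pushes a point just beyond one lower bound
    by midpoints, and it is used whenever a new lower bound overtakes the current point. *)
Lemma strictly_between (lo hi : seq R) :
  (forall l h, l \in lo -> h \in hi -> l < h) ->
  exists z, (forall l, l \in lo -> l < z) /\ (forall h, h \in hi -> z < h).
Proof.
have above (l : R) : (forall h, h \in hi -> l < h) ->
    exists2 z, l < z & forall h, h \in hi -> z < h.
  elim: hi => [_|h hi IH lt]; first by exists (l + 1) => //; lra.
  have [h' hh'|z lz zh] := IH; first by apply: lt; rewrite inE hh' orbT.
  have lh : l < h by apply: lt; rewrite mem_head.
  exists (Num.min z ((l + h) / 2)); first by rewrite lt_min lz; lra.
  move=> h'; rewrite inE gt_min => /orP[/eqP->|/zh->//].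
  by rewrite (_ : (l + h) / 2 < h) ?orbT //; lra.
elim: lo => [_|l lo IH lt].
  elim: hi {above} => [|h hi [z [_ zh]]]; first by exists 0.
  exists (Num.min z (h - 1)); split=> // h'.
  rewrite inE gt_min => /orP[/eqP->|/zh->//].
  by rewrite (_ : h - 1 < h) ?orbT //; lra.
have [l' h l'lo hhi|z [lz zh]] := IH; first by apply: lt; rewrite ?inE ?l'lo ?orbT.
have [zl|lz'] := leP z l; last first.
  by exists z; split=> // l'; rewrite inE => /orP[/eqP->|/lz].
have [h hhi|z' lz' zh'] := above l; first by apply: lt; rewrite ?mem_head.
exists z'; split=> // l'; rewrite inE => /orP[/eqP->//|/lz h].
exact: lt_trans h (le_lt_trans zl lz').
Qed.

(* The sequence is built greedily: the lower bounds [y p - 1] (one for every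
   [p] with [~~ inside p N]) lie below the upper bounds [y p] and [y p - 1]
   (the latter when [inside p N]) that constrain the next term. *)
Lemma unit_interval_realization (inside tight : rel nat) (N : nat) :
  (forall p q p' q', inside p q -> (p' <= p)%N -> (q <= q')%N -> inside p' q') ->
  (forall p q, tight p q ->
     [/\ inside p q, ~~ inside p q.-1 & ~~ inside p.+1 q]) ->
  exists y : nat -> R, forall p q, (p < q < N)%N ->
    [/\ y q < y p, inside p q -> ~~ tight p q -> 1 < y p - y q,
        tight p q -> y p - y q = 1 & ~~ inside p q -> y p - y q < 1].
Proof.
move=> mono tightP; elim: N => [|N [y yP]]; first by exists (fun=> 0) => p q; lia.
suff [z zP] : exists z : R, forall p, (p < N)%N ->
    [/\ z < y p, inside p N -> ~~ tight p N -> 1 < y p - z,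
        tight p N -> y p - z = 1 & ~~ inside p N -> y p - z < 1].
  exists (fun p => if p == N then z else y p) => p q /andP[pq].
  rewrite ltnS leq_eqVlt => /orP[/eqP qN|qN].
    by rewrite qN in pq *; rewrite eqxx (ltn_eqF pq); apply: zP.
  by rewrite (ltn_eqF qN) (ltn_eqF (ltn_trans pq qN)); apply: yP; rewrite pq.
have ylt p q : (p < q)%N -> (q < N)%N -> y q < y p.
  by move=> pq qN; have [|] := yP p q; rewrite ?pq.
have yle p q : (p <= q)%N -> (q < N)%N -> y q <= y p.
  by rewrite leq_eqVlt => /orP[/eqP->//|pq] qN; apply/ltW/ylt.
have yout p q : (p < N)%N -> (q < N)%N -> ~~ inside p q -> y p - y q < 1.
  move=> pN qN; have [pq|qp] := ltnP p q; first by have [|_ _ _] := yP p q; rewrite ?pq.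
  by have := yle _ _ qp pN; lra.
(* A tight pair forces the new term to be [y p0 - 1]. By [tightP], [p0] is then the last index
   [inside] with [N], and it is not [inside] with any earlier index, so the other constraints follow
   by monotonicity. *)
have [[p0 p0N tp0]|not] := pselect (exists2 p, (p < N)%N & tight p N).
  have [ip0 nip0 nip0'] := tightP _ _ tp0.
  have insideE p : inside p N = (p <= p0)%N.
    have [pp|pp] := leqP p p0; first exact: mono ip0 pp _.
    by apply: contraNF nip0' => h; apply: mono h pp _.
  exists (y p0 - 1) => p pN; split.
  - have [pp|pp] := leqP p p0; first by have := yle _ _ pp p0N; lra.
    suff : y p0 - y p < 1 by lra.
    by apply: yout => //; apply: contra nip0 => h; apply: mono h _ _; lia.
  - rewrite insideE leq_eqVlt => /orP[/eqP->|pp _]; first by rewrite tp0.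
    by have := ylt _ _ pp p0N; lra.
  - move=> tp; have [ip _ nip] := tightP _ _ tp.
    suff -> : p = p0 by ring.
    by apply/eqP; rewrite eqn_leq -insideE ip leqNgt -insideE.
  - by rewrite insideE -ltnNge => pp; have := ylt _ _ pp pN; lra.
pose lo := [seq y p - 1 | p <- iota 0 N & ~~ inside p N].
pose hi := [seq y p | p <- iota 0 N] ++ [seq y p - 1 | p <- iota 0 N & inside p N].
have [l h|z [zlo zhi]] := @strictly_between lo hi.
  move=> /mapP[p]; rewrite mem_filter mem_iota add0n => /and3P[ip _ pN] ->.
  rewrite mem_cat => /orP[] /mapP[q]; rewrite ?mem_filter mem_iota add0n.
    move=> /andP[_ qN] ->; suff : y p - y q < 1 by lra.
    by apply: yout => //; apply: contra ip => h'; apply: mono h' _ (ltnW qN).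
  move=> /and3P[iq _ qN] ->; suff : y p < y q by lra.
  apply: ylt => //; rewrite ltnNge; apply: contra ip => pq.
  exact: mono iq pq _.
exists z => p pN; have pi : p \in iota 0 N by rewrite mem_iota.
split.
- by apply: zhi; rewrite mem_cat (map_f y).
- move=> ip _; suff : z < y p - 1 by lra.
  by apply: zhi; rewrite mem_cat (map_f (fun p => y p - 1)) ?orbT // mem_filter ip.
- by move=> tp; case: not; exists p.
- move=> ip; suff : y p - 1 < z by lra.
  by apply: zlo; rewrite (map_f (fun p => y p - 1)) // mem_filter ip.
Qed.

End Realization.

(** * The diagram of a point of the complement *)

Section Geometry.
Local Open Scope ring_scope.
Local Open Scope classical_set_scope.
Import Order.TTheory GRing.Theory Num.Theory.
Variables (R : realType) (n k : nat).
Hypothesis hk : (0 < k)%N.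
Local Notation V := ('I_n * 'I_k)%type.
Implicit Types (x z : 'rV[R]_n) (u v w : V) (i j : 'I_n).

(** Levels of absolute value below [k] are differences of copy numbers, one of which may be taken to
    be [0]; only level [k] is left over. *)
Lemma shi_level (l : int) : - k%:Z + 1 <= l -> l <= k%:Z ->
  l = k%:Z \/ exists m m' : 'I_k, l = m'%:Z - m%:Z.
Proof.
move=> l1 l2; have [->|lk] := eqVneq l k%:Z; [by left|right].
case: l l1 l2 lk => p l1 l2 lk.
  have pk : (p < k)%N by lia.
  by exists (Ordinal hk), (Ordinal pk) => /=; lia.
have pk : (p.+1 < k)%N by lia.
by exists (Ordinal pk), (Ordinal hk) => /=; lia.
Qed.

Lemma bigminn_leq (T : eqType) (s : seq T) (P : pred T) (F : T -> nat) M t :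
  t \in s -> P t -> (\big[minn/M]_(r <- s | P r) F r <= F t)%N.
Proof.
elim: s => // r s IH; rewrite inE big_cons => /orP[/eqP<- ->|/IH {}IH /IH le].
  exact: geq_minl.
by case: ifP => // _; apply: leq_trans (geq_minr _ _) le.
Qed.

Lemma vvalE x u : vval x u = Defs.coord x u.1 + (nat_of_ord u.2)%:R.
Proof. by []. Qed.

Lemma vval_subE x u v : vval x u - vval x v =
  Defs.coord x u.1 - Defs.coord x v.1 - (v.2%:Z - u.2%:Z)%:~R.
Proof. by rewrite /vval intrB -!pmulrn /=; ring. Qed.

(** Avoiding the levels below [k] means that no two expressions [x_i + m] tie, so the ordering of
    the diagram is strict. *)
Lemma shi_complementP x : shi_complement k x <->
  injective (@vval R n k x) /\
  (forall i j, (i < j)%N -> Defs.coord x i - Defs.coord x j != k%:R).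
Proof.
split=> [cx|[inj cx] i j ij l l1 l2]; last first.
  case: (shi_level l1 l2) => [->|[m [m' ->]]]; first by rewrite -pmulrn cx.
  apply/eqP => e; have : vval x (i, m) - vval x (j, m') = 0.
    by rewrite vval_subE e /= subrr.
  by move/eqP; rewrite subr_eq0 => /eqP/inj[ii]; rewrite ii ltnn in ij.
split; last by move=> i j ij; have := cx i j ij k%:Z; rewrite -pmulrn; apply; lia.
have key u v : (u.1 < v.1)%N -> vval x u <> vval x v.
  move=> uv e; have kv := ltn_ord v.2; have ku := ltn_ord u.2.
  have := cx _ _ uv (v.2%:Z - u.2%:Z).
  rewrite -subr_eq0 -vval_subE e subrr eqxx => h.
  by have // : false by apply: h; lia.
move=> u v e; case: (ltngtP u.1 v.1) => c; first by case: (key _ _ c e).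
  by case: (key _ _ c (esym e)).
apply: pair_val_inj => //; move/eqP: e.
by rewrite /vval (val_inj c) (inj_eq (addrI _)) eqr_nat => /eqP.
Qed.

Lemma vpos_le x u v : (vpos x u <= vpos x v)%N = (vval x v <= vval x u).
Proof.
rewrite /vpos ltnS; have [vu|uv] := leP (vval x v) (vval x u).
  by apply: subset_leq_card; apply/fintype.subsetP => w; rewrite !inE; apply: le_lt_trans.
apply/negbTE; rewrite -ltnNge; apply: proper_card; apply/fintype.properP; split.
  by apply/fintype.subsetP => w; rewrite !inE; apply: lt_trans.
by exists v; rewrite !inE ?ltxx.
Qed.

Lemma vpos_lt x u v : (vpos x u < vpos x v)%N = (vval x v < vval x u).
Proof. by rewrite ltnNge vpos_le -ltNge. Qed.

Lemma vpos_bound x u : (0 < vpos x u <= k * n)%N.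
Proof.
rewrite /vpos /= (_ : (k * n)%N = #|{: V}|); last by rewrite card_prod !card_ord mulnC.
apply: proper_card; apply/fintype.properP; split; first exact: subset_predT.
by exists u; rewrite !inE ?ltxx.
Qed.

Lemma arc0P x u v : reflect
  ((u.1 = v.1 /\ u.2 = v.2.+1 :> nat) \/
   [/\ (u.1 < v.1)%N, u.2 = 0%N :> nat, v.2 = k.-1 :> nat
     & k%:R < Defs.coord x u.1 - Defs.coord x v.1]) (arc0 x u v).
Proof.
apply: (iffP orP) => -[h|h]; [left|right|left|right].
- by case/andP: h => /eqP-> /eqP->.
- by case/and4P: h => -> /eqP-> /eqP-> ->.
- by case: h => e1 e2; apply/andP; split; apply/eqP.
- by case: h => -> e1 e2 ->; apply/and4P; split=> //; apply/eqP.
Qed.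

Lemma vval_sub_step x u v : u.1 = v.1 -> u.2 = v.2.+1 :> nat ->
  vval x u - vval x v = 1.
Proof. by move=> e1 e2; rewrite !vvalE e1 e2 -addn1 natrD; ring. Qed.

(** Turns [x_i - x_j > k] into the statement that the arc from [x_i] to [x_j + k - 1] spans more
    than [1]. *)
Lemma vval_sub_ends x u v : u.2 = 0%N :> nat -> v.2 = k.-1 :> nat ->
  vval x u - vval x v = Defs.coord x u.1 - Defs.coord x v.1 - k%:R + 1.
Proof.
move=> e1 e2; have ek : k%:R = k.-1%:R + 1 :> R by rewrite natr1 prednK.
by rewrite !vvalE e1 e2 ek; ring.
Qed.

Lemma arc0_ge1 x u v : arc0 x u v -> 1 <= vval x u - vval x v.
Proof.
case/arc0P=> [[e1 e2]|[_ e1 e2 h]]; first by rewrite vval_sub_step.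
by rewrite vval_sub_ends //; lra.
Qed.

Lemma arc_sub x u v : Defs.arc x u v -> arc0 x u v.
Proof. by case/andP. Qed.

Lemma arc_nonnesting x u v u' v' : Defs.arc x u v -> arc0 x u' v' ->
  (vpos x u <= vpos x u')%N -> (vpos x v' <= vpos x v)%N -> (u', v') = (u, v).
Proof.
case/andP=> _ /existsPn nest uv' le le'; apply/eqP; apply: contraT => ne.
by have /existsPn/(_ v')/negP[] := nest u'; apply/and4P.
Qed.

Lemma arc_vpos x u v : Defs.arc x u v -> (vpos x u < vpos x v)%N.
Proof. by move=> /arc_sub/arc0_ge1 h; rewrite vpos_lt; lra. Qed.

Lemma arc_mono x u v u' v' : Defs.arc x u v -> Defs.arc x u' v' ->
  (vpos x u < vpos x u')%N -> (vpos x v < vpos x v')%N.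
Proof.
move=> uv uv' lt; rewrite ltnNge; apply/negP => le.
have [uu _] := arc_nonnesting uv (arc_sub uv') (ltnW lt) le.
by rewrite uu ltnn in lt.
Qed.

(** Two arcs with a common origin are nested, so at most one survives; likewise for a common end. *)
Lemma arc_succ_uniq x u v v' : Defs.arc x u v -> Defs.arc x u v' -> v = v'.
Proof.
move=> uv uv'; have [le|le] := leqP (vpos x v') (vpos x v).
  by case: (arc_nonnesting uv (arc_sub uv') (leqnn _) le).
by case: (arc_nonnesting uv' (arc_sub uv) (leqnn _) (ltnW le)).
Qed.

Lemma arc_pred_uniq x u u' v : Defs.arc x u v -> Defs.arc x u' v -> u = u'.
Proof.
move=> uv uv'; have [le|le] := leqP (vpos x u) (vpos x u').
  by case: (arc_nonnesting uv (arc_sub uv') le (leqnn _)).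
by case: (arc_nonnesting uv' (arc_sub uv) (ltnW le) (leqnn _)).
Qed.

Lemma arc_letter x u v : Defs.arc x u v -> (u.1 <= v.1)%N.
Proof. by move=> /arc_sub/arc0P[[->]//|[/ltnW]]. Qed.

Lemma connect_arc_letter x u v : connect (Defs.arc x) u v -> (u.1 <= v.1)%N.
Proof.
move=> uv; apply: (connect_ind (P := fun w => (u.1 <= w.1)%N) _ uv) => // w w' uw ww'.
exact: leq_trans uw (arc_letter ww').
Qed.

Lemma connect_arc_vpos x u v : connect (Defs.arc x) u v -> (vpos x u <= vpos x v)%N.
Proof.
move=> uv; apply: (connect_ind (P := fun w => (vpos x u <= vpos x w)%N) _ uv) => // w w' uw ww'.
exact: leq_trans uw (ltnW (arc_vpos ww')).
Qed.

Lemma adj_connect_total x u v : connect (adj x) u v ->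
  connect (Defs.arc x) u v \/ connect (Defs.arc x) v u.
Proof.
move=> uv; apply: connect_undirected_total => //.
- exact: arc_succ_uniq.
- exact: arc_pred_uniq.
Qed.

Lemma adj_connect_sym x : connect_sym (@adj R n k x).
Proof. by apply: sym_connect_sym => u v; rewrite /adj orbC. Qed.

(** * Arcs, chains and labels at a fixed point of the complement *)

Section Complement.
Variable x : 'rV[R]_n.
Hypothesis cx : shi_complement k x.

Lemma vval_inj : injective (@vval R n k x).
Proof. by case/shi_complementP: cx. Qed.

Lemma vpos_inj : injective (@vpos R n k x).
Proof.
move=> u v e; apply: vval_inj; apply/eqP.
by rewrite eq_le -!vpos_le e leqnn.
Qed.

(** This arc spans exactly [1], and an arc inside it spans at least [1], so both have the same
    endpoints. *)
Lemma arc_step u v : u.1 = v.1 -> u.2 = v.2.+1 :> nat -> Defs.arc x u v.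
Proof.
move=> e1 e2; apply/andP; split; first by apply/arc0P; left.
apply/existsPn => u'; apply/existsPn => v'; apply/negP => /and4P[uv' ne].
rewrite !vpos_le => le1 le2; move/negP: ne; apply.
have := arc0_ge1 uv'; have := vval_sub_step x e1 e2 => h1 h2.
have -> : u' = u by apply: vval_inj; lra.
by have -> : v' = v by apply: vval_inj; lra.
Qed.

(** Descent on the length in positions: a removed arc contains a different one, which is strictly
    shorter because positions are injective. *)
Lemma arc0_contains_arc u v : arc0 x u v -> exists u' v',
  [/\ Defs.arc x u' v', (vpos x u <= vpos x u')%N & (vpos x v' <= vpos x v)%N].
Proof.
have [N] := ubnP (vpos x v - vpos x u); elim: N => // N IH in u v *.
rewrite ltnS => uvN a0; have [a|] := boolP (Defs.arc x u v); first by exists u, v.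
rewrite /Defs.arc a0 negbK => /existsP[u' /existsP[v' /and4P[a0' ne le1 le2]]].
have lt : (vpos x u' < vpos x v')%N by have := arc0_ge1 a0'; rewrite vpos_lt; lra.
have ne' : (vpos x u != vpos x u') || (vpos x v != vpos x v').
  apply: contraNT ne; rewrite negb_or !negbK => /andP[/eqP/vpos_inj-> /eqP/vpos_inj->].
  exact: eqxx.
have [|u2 [v2 [a2 le3 le4]]] := IH u' v' _ a0'; first by case/orP: ne'; lia.
by exists u2, v2; split=> //; [apply: leq_trans le1 le3 | apply: leq_trans le4 le2].
Qed.

(** Recovers the side of [x_i - x_j = k] from the surviving arcs. An arc in between gives a
    difference of at least [k], and equality is excluded in the complement. *)
Lemma far_arc u v : (u.1 < v.1)%N -> u.2 = 0%N :> nat -> v.2 = k.-1 :> nat ->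
  k%:R < Defs.coord x u.1 - Defs.coord x v.1 <->
  exists u' v', [/\ Defs.arc x u' v', (vpos x u <= vpos x u')%N
                  & (vpos x v' <= vpos x v)%N].
Proof.
move=> lt e1 e2; split=> [h|[u' [v' [a]]]].
  by apply: arc0_contains_arc; apply/arc0P; right.
rewrite !vpos_le => le1 le2; have := arc0_ge1 (arc_sub a).
have := vval_sub_ends x e1 e2 => h1 h2.
case/shi_complementP: cx => _ /(_ _ _ lt) ne; rewrite lt_neqAle eq_sym ne /=; lra.
Qed.

Lemma copies_connected i (m m' : 'I_k) : connect (adj x) (i, m) (i, m').
Proof.
have down (p : 'I_k) : connect (adj x) (i, p) (i, Ordinal hk).
  case: p => p; elim: p => [|p IH] pk; first by rewrite (_ : Ordinal pk = Ordinal hk) //; apply: val_inj.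
  apply: connect_trans (IH (ltnW pk)); apply: connect1.
  by rewrite /adj arc_step.
by apply: connect_trans (down m) _; rewrite adj_connect_sym.
Qed.

Lemma sigma_ptP u : exists2 w, connect (adj x) u w &
  sigma_pt k x u.1 = vpos x w /\
  forall v, connect (adj x) u v -> (vpos x w <= vpos x v)%N.
Proof.
have E v : [exists m : 'I_k, connect (adj x) (u.1, m) v] = connect (adj x) u v.
  apply/existsP/idP => [[m]|uv]; last by exists u.2; case: (u) uv.
  by apply: connect_trans; case: (u) => i m'; apply: copies_connected.
case: (@arg_minnP _ u (connect (adj x) u) (@vpos R n k x)) => [|w uw minw].
  exact: connect0.
exists w => //; split=> //; rewrite /sigma_pt ffunE (eq_bigl _ _ E).
apply/eqP; rewrite eqn_leq bigminn_leq ?mem_index_enum //=.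
(* The default value [(k * n).+1] exceeds every position, so it never is the minimum. *)
elim/big_ind: _ => [|p q|v]; last exact: minw.
- by case/andP: (vpos_bound x w) => _ /leqW.
- by rewrite leq_min => -> ->.
Qed.

(** Labels separate chains because the leftmost element is determined by its position. *)
Lemma sigma_pt_connect u v :
  connect (adj x) u v <-> sigma_pt k x u.1 = sigma_pt k x v.1.
Proof.
have [w uw [-> minw]] := sigma_ptP u; have [w' vw [-> minw']] := sigma_ptP v.
split=> [uv|/vpos_inj ww].
  apply/eqP; rewrite eqn_leq minw ?minw' //.
  - by apply: connect_trans uw; rewrite adj_connect_sym.
  - exact: connect_trans uv vw.
by apply: connect_trans uw _; rewrite ww adj_connect_sym.
Qed.

(** A chain is a directed path along which letters weakly increase, so after copy [0] of a letter
    comes the top copy of the next larger letter with the same label. Thus the labels alone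
    determine the arcs. *)
Lemma arcE u v : Defs.arc x u v = chain_arc (sigma_pt k x) u v.
Proof.
apply/idP/chain_arcP => [a|[[e1 e2]|[lt e1 e2 /sigma_pt_connect uv btw]]]; last first.
- case: (adj_connect_total uv) => [/connect_inv_head|/connect_arc_letter]; last by lia.
  case=> [uv'|[w uw wv]]; first by rewrite uv' ltnn in lt.
  suff <- : w = v by [].
  have uw' : connect (adj x) u w by apply: connect1; rewrite /adj uw.
  have := connect_arc_letter wv.
  have /arc0P[[_]|[ltw _ e2' _]] := arc_sub uw; first by rewrite e1.
  rewrite leq_eqVlt => /orP[/eqP e|lt']; first by apply: pair_val_inj => //; rewrite e2.
  by case: (btw w.1); rewrite ?ltw //; symmetry; apply/sigma_pt_connect.
- exact: arc_step.
have /arc0P[[e1 e2]|[lt e1 e2 far]] := arc_sub a; [by left|right].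
split=> //; first by apply/sigma_pt_connect; apply: connect1; rewrite /adj a.
move=> l /andP[l1 l2] /esym/(@sigma_pt_connect u (l, u.2)).
case/adj_connect_total => [/connect_inv_head|/connect_arc_letter /=]; last by lia.
case=> [e|[w uw /connect_arc_letter]]; first by rewrite e ltnn in l1.
by rewrite (arc_succ_uniq uw a) /=; lia.
Qed.

Lemma vpos_parking_order : parking_order (sigma_pt k x) (@vpos R n k x).
Proof.
split; [exact: vpos_inj|exact: vpos_bound| |move=> u v|move=> u v u' v'];
  rewrite -?arcE; [|exact: arc_vpos|exact: arc_mono].
move=> v /forallP sv; have [w vw [-> minw]] := sigma_ptP v.
apply/eqP; rewrite eqn_leq minw // andbT.
case: (adj_connect_total vw) => [|/connect_inv_last]; first exact: connect_arc_vpos.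
by case=> [->//|[u _]]; rewrite arcE (negbTE (sv u)).
Qed.

End Complement.

(* The order of the expressions [x_i + m] records the side of every hyperplane
   [x_i - x_j = l] with [|l| < k]; only [l = k] needs a separate clause. *)
Definition same_side x z :=
  (forall u v, (vval x u < vval x v) = (vval z u < vval z v)) /\
  (forall i j, (i < j)%N -> (k%:R < Defs.coord x i - Defs.coord x j) =
                            (k%:R < Defs.coord z i - Defs.coord z j)).

(** Positions and arcs depend only on these comparisons; this makes the image of a region
    independent of the chosen point. *)
Lemma same_side_sigma x z : same_side x z -> sigma_pt k x = sigma_pt k z.
Proof.
move=> [sv sf].
have pE : vpos x =1 (@vpos R n k z).
  by move=> u; rewrite /vpos; congr _.+1; apply: eq_card => v; rewrite !inE.
have a0E u v : arc0 x u v = arc0 z u v.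
  by rewrite /arc0; congr (_ || _); case: (ltnP u.1 v.1) => //= /sf->.
have aE u v : adj x u v = adj z u v.
  have a1E u' v' : Defs.arc x u' v' = Defs.arc z u' v'.
    rewrite /Defs.arc a0E; congr (_ && ~~ _); apply: eq_existsb => u1.
    by apply: eq_existsb => v1; rewrite a0E !pE.
  by rewrite /adj !a1E.
apply/ffunP => i; rewrite !ffunE; apply: eq_big => v; last by rewrite pE.
by apply: eq_existsb => m; apply: eq_connect.
Qed.

(** Heart of injectivity: the labels determine the positions by [parking_order_uniq], the arcs by
    [arcE], and then the sides at level [k] by [far_arc]. *)
Lemma sigma_pt_same_side x z : shi_complement k x -> shi_complement k z ->
  sigma_pt k x = sigma_pt k z -> same_side x z.
Proof.
move=> cx cz e.
have pE : vpos x =1 (@vpos R n k z).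
  apply: (@parking_order_uniq _ _ (sigma_pt k x)); first exact: vpos_parking_order.
  by rewrite e; apply: vpos_parking_order.
have aE u v : Defs.arc x u v = Defs.arc z u v by rewrite !arcE // e.
split=> [u v|i j ij]; first by rewrite -!vpos_lt !pE.
have hk' : (k.-1 < k)%N by rewrite prednK.
have h y (cy : shi_complement k y) :=
  far_arc cy (u := (i, Ordinal hk)) (v := (j, Ordinal hk')) ij erefl erefl.
by apply/idP/idP => /h[]// u [v [a le1 le2]]; apply/h => //; exists u, v;
  rewrite -?aE -?pE ?aE ?pE in a le1 le2 *.
Qed.

End Geometry.

(** * Connected components *)

Section Topology.
Local Open Scope ring_scope.
Local Open Scope classical_set_scope.
Import Order.TTheory GRing.Theory Num.Theory.
Variables (R : realType) (n : nat).

Lemma segment_component (A : set 'rV[R]_n) (x z : 'rV[R]_n) :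
  (forall t, 0 <= t <= 1 -> A (x + t *: (z - x))) -> connected_component A x z.
Proof.
move=> Axz; pose f (t : R) : 'rV[R]_n := x + t *: (z - x).
exists (f @` `[0, 1]).
  split.
  - exists 0; first by rewrite /= in_itv /= lexx ler01.
    by rewrite /f scale0r addr0.
  - by move=> y [t]; rewrite /= in_itv /= => /Axz + <-.
  - apply: connected_continuous_connected; first exact: segment_connected.
    apply: continuous_subspaceT => t; apply: cvgD; first exact: cvg_cst.
    exact: scalel_continuous.
exists 1; first by rewrite /= in_itv /= lexx ler01.
by rewrite /f scale1r addrC subrK.
Qed.

(** Intermediate value theorem: the image of a connected set is an interval, here one that misses
    [0]. *)
Lemma component_sign (A : set 'rV[R]_n) (f : 'rV[R]_n -> R) (x z : 'rV[R]_n) :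
  continuous f -> (forall y, A y -> f y != 0) -> connected_component A x z ->
  (f x < 0) = (f z < 0).
Proof.
move=> cf f0 [C [Cx CA /connected_continuous_connected]].
move=> /(_ _ f (continuous_subspaceT cf))/connected_intervalP itv Cz.
have key y y' : C y -> C y' -> f y < 0 -> f y' < 0.
  move=> Cy Cy' fy; rewrite ltNge; apply/negP => fy'.
  have [|||w Cw fw] := itv (f y) (f y') _ _ 0; [by exists y|by exists y'| |].
    by rewrite (ltW fy).
  by move: (f0 w (CA _ Cw)); rewrite fw eqxx.
by apply/idP/idP; apply: key.
Qed.

End Topology.

(** * Regions as classes of points on the same side, and realization of reading orders *)

Section Regions.
Local Open Scope ring_scope.
Local Open Scope classical_set_scope.
Import Order.TTheory GRing.Theory Num.Theory.
Variables (R : realType) (n k : nat).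
Hypothesis hk : (0 < k)%N.
Local Notation V := ('I_n * 'I_k)%type.
Implicit Types (x y z : 'rV[R]_n) (u v w : V) (i j : 'I_n).

Lemma convex_comb_gt0 (t p q : R) : 0 <= t <= 1 -> 0 < p -> 0 < q ->
  0 < (1 - t) * p + t * q.
Proof.
move=> /andP[]; rewrite le_eqVlt => /orP[/eqP<-|t0] t1 p0 q0.
  by rewrite subr0 mul1r mul0r addr0.
by apply: ltr_wpDl; [apply: mulr_ge0; lra | apply: mulr_gt0].
Qed.

(** Each side is given by a strict linear inequality, which persists along the segment from [x] to
    [z]. *)
Lemma same_side_component x z : shi_complement k x -> shi_complement k z ->
  same_side k x z -> connected_component (shi_complement k) x z.
Proof.
move=> /(shi_complementP hk)[xi xk] /(shi_complementP hk)[zi zk] [sv sf].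
apply: segment_component => t t01.
have cE i : Defs.coord (x + t *: (z - x)) i =
    (1 - t) * Defs.coord x i + t * Defs.coord z i.
  by rewrite /Defs.coord !mxE; ring.
apply/(shi_complementP hk); split.
  have key u v : vval x u < vval x v ->
      vval (x + t *: (z - x)) u < vval (x + t *: (z - x)) v.
    move=> lt; have := lt; rewrite sv => lt'; rewrite -subr_gt0 in lt *.
    rewrite -subr_gt0 in lt'; have := convex_comb_gt0 t01 lt lt'.
    by rewrite !vvalE !cE; lra.
  move=> u v e; apply: xi; apply/eqP; case: ltgtP => // /key.
  - by rewrite e ltxx.
  - by rewrite e ltxx.
move=> i j ij; have := sf _ _ ij; rewrite !cE.
case: (ltgtP k%:R (Defs.coord x i - Defs.coord x j)) => [lt /esym lt'|lt /esym/negbT|e];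
  last by move: (xk _ _ ij); rewrite -e eqxx.
  rewrite -subr_gt0 in lt; rewrite -subr_gt0 in lt'.
  by have h := convex_comb_gt0 t01 lt lt'; apply/eqP; lra.
rewrite -leNgt le_eqVlt (negbTE (zk _ _ ij)) /= => lt'.
rewrite -subr_gt0 in lt; rewrite -subr_gt0 in lt'.
by have h := convex_comb_gt0 t01 lt lt'; apply/eqP; lra.
Qed.

Lemma component_same_side x z :
  connected_component (shi_complement k) x z -> same_side k x z.
Proof.
move=> xz.
have cc i : continuous (fun y : 'rV[R]_n => Defs.coord y i) by exact: coord_continuous.
have cv u : continuous (fun y => vval y u).
  by move=> y; exact: (cvgD (cc u.1 y) (cvg_cst _)).
split=> [u v|i j ij].
  have [->|uv] := eqVneq u v; first by rewrite !ltxx.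
  rewrite -[LHS]subr_lt0 -[RHS]subr_lt0.
  apply: (component_sign (f := fun y => vval y u - vval y v)) xz.
    by move=> y; exact: (cvgB (cv u y) (cv v y)).
  by move=> y /(shi_complementP hk)[inj _]; rewrite subr_eq0 (inj_eq inj).
rewrite -[LHS]subr_lt0 -[RHS]subr_lt0.
apply: (component_sign (f := fun y => k%:R - (Defs.coord y i - Defs.coord y j))) xz.
  by move=> y; exact: (cvgB (cvg_cst _) (cvgB (cc i y) (cc j y))).
by move=> y /(shi_complementP hk)[_ /(_ _ _ ij)]; rewrite subr_eq0 eq_sym.
Qed.

(** Real values [y] are assigned to the positions so that consecutive copies differ by exactly [1],
    and other pairs by more than [1] precisely when a chain arc lies between them. The coordinates
    are then the values at the copies [0]. *)
Lemma parking_order_realized (a : {ffun 'I_n -> nat}) (pos : V -> nat) :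
  parking_order a pos ->
  exists2 x : 'rV[R]_n, shi_complement k x & sigma_pt k x = a.
Proof.
move=> po; case: (po) => pinj pbd pst parc pnon.
pose inside (p q : nat) := [exists u, exists v,
  [&& chain_arc a u v, p <= pos u & pos v <= q]%N].
pose tight (p q : nat) := [exists u : V, exists v : V,
  [&& u.1 == v.1, nat_of_ord u.2 == v.2.+1, pos u == p & pos v == q]].
have insideP p q : reflect
    (exists u v, [/\ chain_arc a u v, (p <= pos u)%N & (pos v <= q)%N]) (inside p q).
  apply: (iffP existsP) => [[u /existsP[v /and3P[h1 h2 h3]]]|[u [v [h1 h2 h3]]]].
    by exists u, v.
  by exists u; apply/existsP; exists v; apply/and3P.
have tightP u v : tight (pos u) (pos v) = (u.1 == v.1) && (nat_of_ord u.2 == v.2.+1).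
  apply/existsP/andP => [[u' /existsP[v' /and4P[e1 e2 /eqP/pinj<- /eqP/pinj<-]]]//|[e1 e2]].
  by exists u; apply/existsP; exists v; rewrite e1 e2 !eqxx.
(* Positions run from [1] to [k * n], hence the bound [(k * n).+1]. The requirements on tight pairs
   hold because chain arcs are not nested. *)
have [p q p' q'|p q|y yP] := @unit_interval_realization R inside tight (k * n).+1.
- move=> /insideP[u [v [uv le1 le2]]] le3 le4; apply/insideP; exists u, v; split=> //.
  + exact: leq_trans le3 le1.
  + exact: leq_trans le2 le4.
- case/existsP=> u /existsP[v /and4P[/eqP e1 /eqP e2 /eqP<- /eqP<-]].
  have uv : chain_arc a u v by apply/chain_arcP; left.
  split; first by apply/insideP; exists u, v.
  + apply/insideP => -[u' [v' [uv' le1 le2]]].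
    have pv := parc _ _ uv; have lt : (pos v' < pos v)%N by lia.
    move: le1; rewrite leq_eqVlt => /orP[/eqP/pinj uu|/(pnon _ _ _ _ uv uv')]; last by lia.
    by rewrite -uu in uv'; rewrite (chain_arc_succ_uniq uv uv') ltnn in lt.
  + by apply/insideP => -[u' [v' [uv' /(pnon _ _ _ _ uv uv')]]]; lia.
have ylt u v : (y (pos u) < y (pos v)) = (pos v < pos u)%N.
  have lt u' v' : (pos u' < pos v')%N -> y (pos v') < y (pos u').
    move=> h; have [|//] := yP (pos u') (pos v').
    by case/andP: (pbd v') => _; rewrite h ltnS.
  case: (ltngtP (pos v) (pos u)) => [/lt//|/lt/ltW|->]; last exact: ltxx.
  by rewrite leNgt => /negbTE.
have yPp u v (h : (pos u < pos v)%N) : [/\ inside (pos u) (pos v) ->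
    ~~ tight (pos u) (pos v) -> 1 < y (pos u) - y (pos v),
    tight (pos u) (pos v) -> y (pos u) - y (pos v) = 1
    & ~~ inside (pos u) (pos v) -> y (pos u) - y (pos v) < 1].
  by have [|] := yP (pos u) (pos v); rewrite // h ltnS; case/andP: (pbd v).
pose x : 'rV[R]_n := \row_i y (pos (i, Ordinal hk)).
have vE u : vval x u = y (pos u).
  case: u => i [m mk]; rewrite vvalE /=; elim: m mk => [|m IH] mk.
    rewrite addr0 /Defs.coord mxE; congr (y (pos (_, _))); exact: val_inj.
  have mk' := ltnW mk; rewrite -natr1 addrA (IH mk').
  have uv : chain_arc a (i, Ordinal mk) (i, Ordinal mk').
    by apply/chain_arcP; left; split.
  have [_ + _] := yPp _ _ (parc _ _ uv); rewrite tightP !eqxx => /(_ isT); lra.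
have pE u : vpos x u = pos u.
  have [p0 pn] := andP (pbd u).
  rewrite /vpos -[RHS](prednK p0); congr _.+1.
  rewrite -[RHS](parking_order_card po (leq_trans (leq_pred _) pn)).
  by apply: eq_card => v; rewrite !inE !vE ylt -[RHS]ltnS (prednK p0).
have cx : shi_complement k x.
  apply/(shi_complementP hk); split.
    move=> u v; rewrite !vE => e; apply: pinj.
    by case: (ltngtP (pos u) (pos v)) => //; rewrite -ylt e ltxx.
  move=> i j ij; have hk' : (k.-1 < k)%N by rewrite prednK.
  pose u : V := (i, Ordinal hk); pose v : V := (j, Ordinal hk').
  have := vval_sub_ends hk x (erefl : u.2 = 0%N :> nat) (erefl : v.2 = k.-1 :> nat).
  rewrite !vE /= => e.
  (* Only tight pairs differ by exactly [1], and these belong to a single letter. *)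
  suff : y (pos u) - y (pos v) != 1.
    by apply: contraNneq => h; rewrite e h subrr add0r.
  case: (ltnP (pos u) (pos v)) => [lt|le].
    have nt : ~~ tight (pos u) (pos v).
      by rewrite tightP /= negb_and; apply/orP; left; apply: contraTneq ij => ->; rewrite ltnn.
    have [yin _ yout] := yPp _ _ lt.
    have [h|h] := boolP (inside (pos u) (pos v)).
      by rewrite gt_eqF // yin.
    by rewrite lt_eqF // yout.
  by move: le; rewrite leqNgt -ylt -leNgt => le; apply/eqP; lra.
have a0 u v : chain_arc a u v -> arc0 x u v.
  move=> uv; apply/arc0P; case/chain_arcP: (uv) => [|[lt e1 e2 _ _]]; [by left|right].
  split=> //; have [yin _ _] := yPp _ _ (parc _ _ uv).
  have := vval_sub_ends hk x e1 e2; rewrite !vE => e.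
  suff : 1 < y (pos u) - y (pos v) by rewrite e; lra.
  apply: yin; first by apply/insideP; exists u, v.
  by rewrite tightP negb_and; apply/orP; left; apply: contraTneq lt => ->; rewrite ltnn.
have a0in u v : arc0 x u v -> inside (pos u) (pos v).
  move=> uv; have ge1 := arc0_ge1 hk uv.
  case/arc0P: (uv) => [[e1 e2]|[lt e1 e2 far]].
    by apply/insideP; exists u, v; split=> //; apply/chain_arcP; left.
  have := vval_sub_ends hk x e1 e2; rewrite !vE in ge1 * => e.
  have puv : (pos u < pos v)%N by rewrite -ylt; lra.
  have [_ _ yout] := yPp _ _ puv; apply: contraT => /yout; lra.
(* Chain arcs are arcs of the unreduced diagram, every arc of that diagram contains a chain arc, and
   chain arcs are not nested; so the removal leaves exactly the chain arcs. *)
have aE u v : Defs.arc x u v = chain_arc a u v.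
  apply/idP/idP => [uv|uv].
    have /insideP[u' [v' [uv' le1 le2]]] := a0in _ _ (arc_sub uv).
    rewrite -!pE in le1 le2.
    by have [<- <-] := arc_nonnesting uv (a0 _ _ uv') le1 le2.
  apply/andP; split; first exact: a0.
  apply/existsPn => u'; apply/existsPn => v'; apply/negP => /and4P[uv' /negP ne].
  rewrite !pE => le1 le2; apply: ne.
  have /insideP[u2 [v2 [uv2 le3 le4]]] := a0in _ _ uv'.
  have : (pos u <= pos u2)%N := leq_trans le1 le3.
  rewrite leq_eqVlt => /orP[/eqP/pinj uu|/(pnon _ _ _ _ uv uv2)]; last by lia.
  rewrite -uu in uv2 le3; have vv := chain_arc_succ_uniq uv uv2; rewrite -vv in le4.
  have -> : u' = u by apply: pinj; lia.
  by have -> : v' = v by apply: pinj; lia.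
exists x => //; apply/ffunP => i.
have [w iw [-> minw]] := sigma_ptP hk cx (i, Ordinal hk).
have aw : a i = a w.1.
  apply: (connect_ind (P := fun w => a i = a w.1) _ iw) => // v v' ->.
  by rewrite /adj !aE => /orP[] /chain_arc_class.
(* The leftmost position is at least the label by [parking_order_ge], and the chain start attains
   it. *)
have [s ss si] := chain_start_exists a (i, Ordinal hk).
apply/eqP; rewrite eqn_leq pE {2}aw parking_order_ge // andbT.
rewrite -[a i]/(a (i, Ordinal hk).1) -(chain_connect_class si) -pst //.
rewrite -!pE minw // adj_connect_sym.
by apply: connect_sub si => u v uv; apply: connect1; rewrite /adj aE uv.
Qed.

(** [sigma] evaluates at a chosen point; since that point lies in the region, the region is its
    component. *)
Lemma shi_region_sigma (A : set 'rV[R]_n) : shi_region k A -> exists x,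
  [/\ shi_complement k x, A = connected_component (shi_complement k) x
    & sigma k A = sigma_pt k x].
Proof.
move=> [x cx AE]; have Ax : A x by rewrite AE; apply: connected_component_refl.
have xz : connected_component (shi_complement k) x (xget 0 A).
  by rewrite -AE; apply: xgetI Ax.
exists (xget 0 A); split=> //.
- exact: connected_component_sub xz.
- by rewrite {1}AE; apply: same_connected_component.
Qed.

End Regions.

Theorem theorem3p5 (R : realType) (n k : nat) (hn : (0 < n)%N) (hk : (0 < k)%N) :
  (forall A : set 'rV[R]_n, shi_region k A -> k_parking k (sigma k A)) /\
  (forall A B : set 'rV[R]_n, shi_region k A -> shi_region k B ->
     sigma k A = sigma k B -> A = B) /\
  (forall a : {ffun 'I_n -> nat}, k_parking k a ->
     exists2 A : set 'rV[R]_n, shi_region k A & sigma k A = a).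
Proof.
split; [|split].
- move=> A /(shi_region_sigma)[x [cx _ ->]].
  exact: parking_order_k_parking hk (vpos_parking_order hk cx).
- move=> A B /shi_region_sigma[x [cx -> ->]] /shi_region_sigma[z [cz -> ->]] e.
  apply: same_connected_component; apply: (same_side_component hk cx cz).
  exact: sigma_pt_same_side.
- move=> a /parking_order_exists[pos /(parking_order_realized R hk)[x cx <-]].
  pose A := connected_component (shi_complement k) x.
  have rA : shi_region k A by exists x.
  (* The chosen point [z] may differ from [x], but it lies in the same component and so gives the
     same labels. *)
  exists A => //; have [z [cz AE ->]] := shi_region_sigma rA.
  apply: same_side_sigma; apply: (component_same_side hk).
  by rewrite -AE; apply: connected_component_refl.
Qed.
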